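(* The worst-case running time of Zielonka's recursive algorithm on (nested) solitaire parity games, as a function of the number of vertices $|V|$, is $\Omega(2^{|V|/3})$.
   Context: A parity game $G=(V,E,\mathcal{P},(V_\Diamond,V_\Box))$ consists of a finite vertex set $V$ partitioned into $V_\Diamond$ (owned by player even, $\Diamond$) and $V_\Box$ (owned by player odd, $\Box$), a total edge relation $E\subseteq V\times V$ (write $v\to w$) and a priority function $\mathcal{P}:V\to\mathbb{N}$. Player $\Diamond$ wins an infinite play iff the highest priority occurring infinitely often is even; a vertex is won by player $i$ if $i$ has a strategy winning every consistent play from it; solving means computing the winning regions $(W_\Diamond,W_\Box)$. For $A\subseteq V$, $G\setminus A$ is the game restricted to $V\setminus A$. $\overline{i}$ is the opponent of $i$. The $i$-attractor $\mathit{Attr}_i(U)$ of $U\subseteq V$ is the least superset of $U$ closed under adding vertices of $V_i$ having some successor in the set and vertices of $V_{\overline i}$ all of whose successors are in the set. Zielonka's algorithm $\textsc{Zielonka}(G)$: if $V=\emptyset$ return $(\emptyset,\emptyset)$. Otherwise let $m$ be the maximal priority, $p=\Diamond$ if $m$ even else $p=\Box$, $U=\{v\mid\mathcal{P}(v)=m\}$, $A=\mathit{Attr}_p(U)$, $(W'_\Diamond,W'_\Box)=\textsc{Zielonka}(G\setminus A)$. If $W'_{\overline p}=\emptyset$, return $W_p=A\cup W'_p$, $W_{\overline p}=\emptyset$. Otherwise let $B=\mathit{Attr}_{\overline p}(W'_{\overline p})$, $(W''_\Diamond,W''_\Box)=\textsc{Zielonka}(G\setminus B)$, and return $W_p=W''_p$,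 $W_{\overline p}=W''_{\overline p}\cup B$. A parity game is solitaire if all non-trivial moves (vertices with more than one successor) belong to a single player; it is nested solitaire if the subgame induced by each strongly connected component is a solitaire game. *)

(* Defs.v *)
From HB Require Import structures.
From mathcomp Require Import all_boot all_order all_algebra.
From mathcomp Require Import all_classical all_reals all_analysis.
Set Implicit Arguments.
Unset Strict Implicit.
Unset Printing Implicit Defensive.
Import Order.TTheory GRing.Theory Num.Theory.

Inductive player := Even | Odd.

Definition opp (i : player) : player := if i is Even then Odd else Even.

Record parity_game := ParityGame {
  vertex : finType;
  edge : rel vertex;
  edge_total : forall v, exists w, edge v w;
  priority : vertex -> nat;
  even_vertices : {set vertex}
}.

Section Games.
Variable G : parity_game.
Implicit Types (S U X : {set vertex G}) (i p : player) (v w : vertex G).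

Definition owned i : {set vertex G} :=
  if i is Even then even_vertices G else ~: even_vertices G.

(* Subgames are represented by their vertex sets: [S] stands for the
   restriction of [G] to [S], in which only the edges inside [S] remain. *)
Definition succ S v : {set vertex G} := [set w in S | edge v w]%SET.

Definition attr_closed S i X : bool :=
  [forall v in S,
     ((v \in owned i) && (succ S v :&: X != finset.set0)) ||
     ((v \in owned (opp i)) && (succ S v \subset X))
   ==> (v \in X)].

Definition attr S i U : {set vertex G} :=
  \bigcap_(X : {set vertex G} | (U \subset X) && attr_closed S i X) X.

(* Stated for vertex sets that need not induce a total game, since a trivial
   strongly connected component has no edge. *)
Definition solitaire_on S : Prop :=
  exists i, forall v, v \in S -> 1 < #|succ S v| -> v \in owned i.

Definition scc v : {set vertex G} :=
  [set w | connect (@edge G) v w && connect (@edge G) w v]%SET.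

Definition solitaire : Prop := solitaire_on [set: vertex G]%SET.

Definition nested_solitaire : Prop := forall v, solitaire_on (scc v).

(* Winning regions, in the order (Even, Odd). *)
Definition regions : Type := ({set vertex G} * {set vertex G})%type.

Definition win (W : regions) i := if i is Even then W.1 else W.2.

Definition mk_regions p X Y : regions := if p is Even then (X, Y) else (Y, X).

(* [work S] is the time spent in the invocation on the subgame [S] itself,
   that is, outside its recursive calls. *)
Variable work : {set vertex G} -> nat.

(* The body of the algorithm, instrumented to return the total time spent
   together with the winning regions; [rec] serves the recursive calls. *)
Definition zielonka_step (rec : {set vertex G} -> regions * nat) S
    : regions * nat :=
  if S == finset.set0 then ((finset.set0, finset.set0), work S) else
  let m := \max_(v in S) priority v in
  let p := if odd m then Odd else Even in
  let U := [set v in S | priority v == m]%SET in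
  let A := attr S p U in
  let: (W1, t1) := rec (S :\: A) in
  if win W1 (opp p) == finset.set0 then
    (mk_regions p (A :|: win W1 p) finset.set0, work S + t1)
  else
    let B := attr S (opp p) (win W1 (opp p)) in
    let: (W2, t2) := rec (S :\: B) in
    (mk_regions p (win W2 p) (win W2 (opp p) :|: B), work S + t1 + t2).

Definition zielonka_iter k : {set vertex G} -> regions * nat :=
  iter k zielonka_step (fun=> ((finset.set0, finset.set0), 0)).

(* Every recursive call is on a strictly smaller set, so a recursion depth of
   [#|S|.+1] is never exhausted; [zielonkaE] is the actual recursion. *)
Definition zielonka S : regions * nat := zielonka_iter #|S|.+1 S.

Lemma sub_attr S i U : U \subset attr S i U.
Proof. by apply/bigcapsP => X /andP[]. Qed.

Lemma attr_sub S i U : U \subset S -> attr S i U \subset S.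
Proof.
move=> US; apply: (finset.bigcap_inf S); rewrite US /=.
by apply/forall_inP => v vS; apply/implyP.
Qed.

Lemma attr_proper S i U : U \subset S -> U != finset.set0 ->
  #|S :\: attr S i U| < #|S|.
Proof.
move=> US /set0Pn[v vU]; apply: proper_card; rewrite properE finset.subsetDl /=.
apply/subsetPn; exists v; first exact: (fintype.subsetP US).
by rewrite inE (fintype.subsetP (sub_attr S i U)).
Qed.

Lemma attr_closedP S i U : attr_closed S i (attr S i U).
Proof.
apply/forall_inP => v vS; apply/implyP => H; apply/finset.bigcapP => X XP.
have /andP[_ /forall_inP/(_ v vS)/implyP] := XP; apply.
have sub : attr S i U \subset X by exact: finset.bigcap_inf.
case/orP: H => /andP[-> H]; apply/orP; [left|right] => /=.
- by apply: contraNneq H => e; rewrite -finset.subset0 -e; exact: finset.setIS.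
- exact: fintype.subset_trans H sub.
Qed.

Let top S : {set vertex G} :=
  [set v in S | priority v == \max_(v in S) priority v]%SET.

Let top_neq0 S : S != finset.set0 -> top S != finset.set0.
Proof.
move=> S0; have S_gt0 : 0 < #|S| by rewrite card_gt0.
have [v vS e] := eq_bigmax_cond (@priority G) S_gt0.
by apply/set0Pn; exists v; rewrite inE e eqxx andbT.
Qed.

Lemma zielonka_iter_sub k S i : win (zielonka_iter k S).1 i \subset S.
Proof.
elim: k S i => [|k IH] S i; first by case: i; exact: finset.sub0set.
rewrite /zielonka_iter iterS -/(zielonka_iter k) /zielonka_step.
case: ifPn => [_|S0]; first by case: i; exact: finset.sub0set.
set p := if odd _ then _ else _; set A := attr S p _.
have AS : A \subset S by apply/attr_sub/fintype.subsetP => v; rewrite inE => /andP[].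
have IHD X j : win (zielonka_iter k (S :\: X)).1 j \subset S.
  exact: fintype.subset_trans (IH _ _) (finset.subsetDl _ _).
have := IHD A; case: (zielonka_iter k (S :\: A)) => W1 t1 /= H1.
case: ifPn => _.
  have HU : A :|: win W1 p \subset S by rewrite finset.subUset AS H1.
  by rewrite /mk_regions; case: i; move: HU; case: (p) => //= _; exact: finset.sub0set.
set B := attr _ _ _; have BS : B \subset S by exact: attr_sub.
have := IHD B; case: (zielonka_iter k (S :\: B)) => W2 t2 /= H2.
have HU : win W2 (opp p) :|: B \subset S by rewrite finset.subUset H2.
by rewrite /mk_regions; case: i; move: HU (H2 p); case: (p).
Qed.

Lemma zielonka_iter_stable k S : #|S| < k -> zielonka_iter k S = zielonka S.
Proof.
rewrite /zielonka; have [n Sn] := ubnP #|S|.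
elim: n => // n IH in S k Sn *; case: k => // k Sk.
rewrite /zielonka_iter !iterS -!/(zielonka_iter _) /zielonka_step.
case: ifPn => // S0.
set p := if odd _ then _ else _; set A := attr S p _.
have eqD X : #|S :\: X| < #|S| ->
    zielonka_iter k (S :\: X) = zielonka_iter #|S| (S :\: X).
  move=> lt; rewrite IH ?(leq_trans lt) //.
  by rewrite [RHS]IH ?(leq_trans lt).
have ltA : #|S :\: A| < #|S|.
  apply: attr_proper; last exact: top_neq0.
  by apply/fintype.subsetP => v; rewrite inE => /andP[].
rewrite eqD //.
have := fun i => zielonka_iter_sub #|S| (S :\: A) i.
case: (zielonka_iter _ (S :\: A)) => W1 t1 /= H1.
case: ifPn => // W0; rewrite eqD //.
by apply: attr_proper => //; exact: fintype.subset_trans (H1 _) (finset.subsetDl _ _).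
Qed.

Lemma zielonkaE S : zielonka S = zielonka_step zielonka S.
Proof.
have e k X : #|X| < k -> zielonka_iter k X = zielonka X.
  exact: zielonka_iter_stable.
rewrite -(e #|S|.+2) // /zielonka_iter iterS -/(zielonka_iter _).
rewrite /zielonka_step; case: ifPn => // _.
have eD X : zielonka_iter #|S|.+1 (S :\: X) = zielonka (S :\: X).
  by rewrite e // ltnS subset_leq_card // subsetDl.
by rewrite eD; case: (zielonka _) => W1 t1; rewrite eD.
Qed.

End Games.

Definition running_time (work : forall G : parity_game, {set vertex G} -> nat)
    (G : parity_game) : nat :=
  (zielonka (work G) [set: vertex G]%SET).2.

Definition worst_case (R : realType) (C : parity_game -> Prop)
    (time : parity_game -> nat) (n : nat) : \bar R :=
  ereal_sup [set x : \bar R | exists G : parity_game,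
    [/\ #|vertex G| = n, C G & x = ((time G)%:R : R)%:E]]%classic.

(* The [Omega] notation of the library is for functions into a normed module;
   this is its counterpart for the extended real [worst_case]. *)
Definition is_Omega (R : realType) (T : nat -> \bar R) (g : nat -> R) : Prop :=
  exists2 c : R, (0 < c)%R & \forall n \near \oo%classic, ((c * g n)%:E <= T n)%E.

(* Main.v *)
(* Zielonka's algorithm is forced to double its work on a tower of [n] levels
   on top of sinks of priority 0. Level [i] consists of a vertex [X] of odd
   priority 2i+3 with edges to the sinks, a vertex [W] of priority 1 with a
   self-loop and an edge to [X], and a vertex [U] of even priority 2i+2 with an
   edge to [W]. Even wins the tower through W -> X -> sink. The recursion first
   removes the topmost [X], after which the [W] below it is won by Odd, and then
   the topmost [U]; the first recursive call inside is on the remaining tower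
   together with that useless [W]. Its Odd-attractor is {U, W}, so the second
   call is on the remaining tower again. Hence T(n+1) >= 2 T(n), with 3 vertices
   per level. The stray [W]s of the higher levels do not interfere. *)

Require Import Defs.
From mathcomp Require Import all_boot all_order all_algebra.
From mathcomp Require Import all_classical all_reals all_analysis.
From mathcomp Require Import zify.

Set Implicit Arguments.
Unset Strict Implicit.
Unset Printing Implicit Defensive.
Import Order.TTheory GRing.Theory Num.Theory.

(** * Attractors and single invocations in an arbitrary game *)

Section ZielonkaCalls.
Variables (G : parity_game) (work : {set vertex G} -> nat).
Implicit Types (S U X A B : {set vertex G}) (v : vertex G).

(** Leastness gives one inclusion; the other stays a premise, to be met by explicit moves. *)
Lemma attr_eq S i U X :
  U \subset X -> attr_closed S i X -> X \subset attr S i U -> attr S i U = X.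
Proof.
move=> UX cX XU; apply/eqP; rewrite finset.eqEsubset XU andbT.
by apply: finset.bigcap_inf; rewrite UX.
Qed.

Lemma attr_id S i U : attr_closed S i U -> attr S i U = U.
Proof. by move=> cU; apply: attr_eq => //; exact: sub_attr. Qed.

Lemma attr_step S i U v w : v \in S -> v \in owned G i -> w \in S ->
  edge v w -> w \in attr S i U -> v \in attr S i U.
Proof.
move=> vS vi wS vw wA.
have /forall_inP/(_ v vS)/implyP := attr_closedP S i U; apply.
by rewrite vi /=; apply/orP; left; apply/set0Pn; exists w; rewrite !inE wS vw.
Qed.

Lemma attr_step_forced S i U v : v \in S -> v \in owned G (Defs.opp i) ->
  (forall w, w \in S -> edge v w -> w \in attr S i U) -> v \in attr S i U.
Proof.
move=> vS vi sub.
have /forall_inP/(_ v vS)/implyP := attr_closedP S i U; apply.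
rewrite vi /=; apply/orP; right; apply/fintype.subsetP => w.
by rewrite !inE => /andP[]; exact: sub.
Qed.

Lemma bigmax_priority S v : v \in S ->
  (forall w, w \in S -> priority w <= priority v) ->
  \max_(w in S) priority w = priority v.
Proof.
move=> vS le_v; apply/eqP; rewrite eqn_leq (leq_bigmax_cond _ vS) andbT.
exact/bigmax_leqP.
Qed.

Definition parity m := if odd m then Odd else Even.

(** Unfolds one invocation that reaches its second recursive call, with the computed priority and
    attractors supplied as premises. *)
Lemma zielonka_two_calls S p m A B :
    S != finset.set0 -> \max_(v in S) priority v = m -> parity m = p ->
    attr S p [set v in S | priority v == m]%SET = A ->
    win (zielonka work (S :\: A)).1 (Defs.opp p) != finset.set0 ->
    attr S (Defs.opp p) (win (zielonka work (S :\: A)).1 (Defs.opp p)) = B ->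
  zielonka work S =
    (mk_regions p (win (zielonka work (S :\: B)).1 p)
                  (win (zielonka work (S :\: B)).1 (Defs.opp p) :|: B),
     work S + (zielonka work (S :\: A)).2 + (zielonka work (S :\: B)).2).
Proof.
move=> S0 Sm <- SA W0 SB; rewrite zielonkaE /zielonka_step (negPf S0) Sm.
rewrite -/(parity m) SA; case: (zielonka work (S :\: A)) W0 SB => W1 t1 /=.
by move=> /negPf -> ->; case: (zielonka _ _).
Qed.

(** The first attractor is already all of [S], so the recursion is on the empty set. *)
Lemma zielonka_const S m : (forall v, v \in S -> priority v = m) ->
  (zielonka work S).1 = mk_regions (parity m) S finset.set0.
Proof.
move=> Sm; rewrite zielonkaE /zielonka_step.
have [-> /=|/set0Pn[v vS]] := eqVneq S finset.set0; first by case: parity.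
have -> : \max_(v in S) priority v = m.
  by rewrite (bigmax_priority vS) ?Sm // => w wS; rewrite !Sm.
rewrite -/(parity m).
have -> : [set v in S | priority v == m]%SET = S.
  by apply/setP => w; rewrite inE; case wS: (w \in S) => //=; rewrite Sm ?eqxx.
have -> : attr S (parity m) S = S.
  by apply/eqP; rewrite finset.eqEsubset sub_attr attr_sub.
rewrite finset.setDv zielonkaE /zielonka_step eqxx.
by case: parity; rewrite /= eqxx finset.setU0.
Qed.

Lemma zielonka_time_gt0 S : (forall X, 0 < work X) -> 0 < (zielonka work S).2.
Proof.
move=> w0; rewrite zielonkaE /zielonka_step; case: ifP => //= _.
case: (zielonka _ _) => W1 t1; case: ifP => _ /=; first by rewrite addn_gt0 w0.
by case: (zielonka _ _) => W2 t2 /=; rewrite !addn_gt0 w0.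
Qed.

End ZielonkaCalls.

(** * The tower game and the recursion on its stages *)

Section Tower.
Variables n r : nat.

(** There is always one sink, so that every [X] has a successor; [r] more pad the number of vertices
    to any residue modulo 3. *)
Definition tower_vertex : finType := ('I_n + 'I_n + 'I_n + 'I_r.+1)%type.

Notation X i := (inl (inl (inl i))).
Notation U i := (inl (inl (inr i))).
Notation W i := (inl (inr i)).
Notation Z j := (inr j).

Definition tower_edge : rel tower_vertex := fun v w =>
  match v, w with
  | X _, Z _ => true
  | U i, W j => i == j
  | W i, W j => i == j
  | W i, X j => i == j
  | Z i, Z j => i == j
  | _, _ => false
  end.

Definition tower_priority (v : tower_vertex) : nat :=
  match v with
  | X i => i.*2.+3
  | U i => i.*2.+2
  | W _ => 1
  | Z _ => 0
  end.

Lemma tower_edge_total v : exists w, tower_edge v w.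
Proof.
case: v => [[[i|i]|i]|j]; [by exists (Z ord0)|by exists (W i); exact: eqxx..|].
by exists (Z j); exact: eqxx.
Qed.

Definition tower : parity_game :=
  ParityGame tower_edge_total tower_priority [set: tower_vertex]%SET.

Lemma card_tower : #|vertex tower| = 3 * n + r.+1.
Proof. by rewrite /= !card_sum !card_ord; lia. Qed.

Lemma tower_solitaire : solitaire tower.
Proof. by exists Even => v _ _; rewrite inE. Qed.

(** As Even owns every vertex, each player keeps only one of the two closure clauses: free choice
    for Even, force for Odd. *)
Lemma attr_closed_Even (S Y : {set vertex tower}) :
  (forall v w, v \in S -> w \in S -> w \in Y -> edge v w -> v \in Y) ->
  attr_closed S Even Y.
Proof.
move=> H; apply/forall_inP => v vS; apply/implyP; rewrite /= !inE /= orbF.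
by case/set0Pn => w; rewrite !inE => /andP[/andP[wS vw] wY]; exact: (H v w).
Qed.

Lemma attr_closed_Odd (S Y : {set vertex tower}) :
  (forall v, v \in S -> v \notin Y ->
     exists w, [/\ w \in S, edge v w & w \notin Y]) ->
  attr_closed S Odd Y.
Proof.
move=> H; apply/forall_inP => v vS; apply/implyP; rewrite /= !inE /=.
move=> /fintype.subsetP vY; apply/negPn/negP => /(H v vS)[w [wS vw /negP]].
by apply; apply: vY; rewrite inE wS.
Qed.

(* The [k] lowest levels, the sinks, and the stray [W i] for [i] in [D]. *)
Definition stage (k : nat) (D : {set 'I_n}) : {set vertex tower} :=
  [set v : tower_vertex | match v with
   | X i => i < k
   | U i => i < k
   | W i => (i < k) || (i \in D)
   | Z _ => true
   end]%SET.

Variable work : {set vertex tower} -> nat.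
Hypothesis work_gt0 : forall S, 0 < work S.

(** The regions belong to the induction because they determine the later calls. Odd wins exactly the
    strays: without its [X], a [W] can only loop at priority 1. *)
Let spec k D :=
  (zielonka work (stage k D)).1 =
    (stage k finset.set0, stage k D :\: stage k finset.set0) /\
  2 ^ k <= (zielonka work (stage k D)).2.

Lemma zielonka_stage0 D : spec 0 D.
Proof.
split; last by rewrite expn0 zielonka_time_gt0.
pose C : {set vertex tower} := stage 0 D :\: stage 0 finset.set0.
have Z1 : (zielonka work (stage 0 finset.set0)).1
    = (stage 0 finset.set0, finset.set0).
  by apply: (@zielonka_const _ _ _ 0) => -[[[i|i]|i]|j]; rewrite !inE.
have C1 : (zielonka work C).1 = (finset.set0, C).
  by apply: (@zielonka_const _ _ _ 1) => -[[[i|i]|i]|j]; rewrite !inE.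
have ZC : stage 0 D :\: C = stage 0 finset.set0.
  by apply/setP => -[[[i|i]|i]|j]; rewrite !inE //=; case: (_ \in D).
(* Without strays the maximal priority is 0 instead of 1, and there is no second call. *)
have [D0|/set0Pn[i iD]] := eqVneq D finset.set0.
  by rewrite D0 Z1 finset.setDv.
have iS : (W i : vertex tower) \in stage 0 D by rewrite !inE iD.
rewrite (@zielonka_two_calls _ _ _ Odd 1 C (stage 0 finset.set0)) //=.
- by rewrite C1 /= finset.set0U.
- by apply/set0Pn; exists (W i).
- rewrite (bigmax_priority iS) //.
  by move=> -[[[l|l]|l]|j]; rewrite !inE.
- have -> : [set v in stage 0 D | tower_priority v == 1]%SET = C.
    by apply/setP => -[[[l|l]|l]|j]; rewrite !inE //= ?andbT.
  apply: (@attr_id tower); apply: attr_closed_Odd => v vS vC.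
  exists v; split => //; move: v vS vC => -[[[l|l]|l]|j]; rewrite !inE //= ?eqxx.
- by rewrite ZC Z1 /=; apply/set0Pn; exists (Z ord0); rewrite inE.
- rewrite ZC Z1 /=; apply: (@attr_id tower); apply: attr_closed_Even.
  by move=> -[[[l|l]|l]|j] -[[[l'|l']|l']|j']; rewrite !inE.
Qed.

(** Both calls at height [k] are made by the invocation on [S1], the first call of [S]. [D] must
    vary, since the first of them gains the stray [W o]. *)
Lemma zielonka_stage_step (k : nat) (o : 'I_n) D : k = o ->
  (forall D', spec k D') -> spec k.+1 D.
Proof.
move=> ko IH.
pose S : {set vertex tower} := stage k.+1 D.
pose Xk : {set vertex tower} := [set X o : vertex tower]%SET.
pose Uk : {set vertex tower} := [set U o : vertex tower]%SET.
pose E : {set vertex tower} := stage k finset.set0.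
pose B : {set vertex tower} := Uk :|: (stage k (o |: D) :\: E).
pose S1 : {set vertex tower} := S :\: Xk.
have US1 : (U o : vertex tower) \in S1 by rewrite !inE -ko ltnSn.
have XS : (X o : vertex tower) \in S by rewrite !inE -ko ltnSn.
(* Equalities with [X o] and [U o] become numerical, which reduces the set identities to
   arithmetic. *)
have eqX : ((forall i, (X i == X o :> vertex tower) = (i == k :> nat))
  * (forall i, (U i == X o :> vertex tower) = false)
  * (forall i, (W i == X o :> vertex tower) = false)
  * (forall i, (Z i == X o :> vertex tower) = false))%type.
  by rewrite ko; do !split.
have eqU : ((forall i, (X i == U o :> vertex tower) = false)
  * (forall i, (U i == U o :> vertex tower) = (i == k :> nat))
  * (forall i, (W i == U o :> vertex tower) = false)
  * (forall i, (Z i == U o :> vertex tower) = false))%type.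
  by rewrite ko; do !split.
have eqo i : (i == o) = (i == k :> nat) by rewrite ko.
have S1U : S1 :\: Uk = stage k (o |: D).
  by apply/setP => -[[[i|i]|i]|j]; rewrite !inE ?eqX ?eqU ?eqo ?ltnS //=;
     case: (ltngtP i k) => //=; case: (i \in D).
have S1B : S1 :\: B = E.
  by apply/setP => -[[[i|i]|i]|j]; rewrite !inE ?eqX ?eqU ?eqo ?ltnS //=;
     case: (ltngtP i k) => //=; case: (i \in D).
have [IH1 IHt1] := IH (o |: D); have [IH2 IHt2] := IH finset.set0.
(* No edge enters a [U]. *)
have attrUk : attr S1 Even Uk = Uk.
  apply: (@attr_id tower); apply: attr_closed_Even.
  by move=> -[[[i|i]|i]|j] -[[[i'|i']|i']|j']; rewrite !inE ?eqX ?eqU ?eqo.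
(* Outside [B], an [X] escapes to a sink, a lower [U] to its [W], and the rest by loops. [U o] is
   forced: its only successor is the stray [W o]. *)
have attrB : attr S1 Odd (stage k (o |: D) :\: E) = B.
  apply: (@attr_eq tower); first exact: finset.subsetUr.
    apply: attr_closed_Odd => v vS vB; case: v vS vB => [[[i|i]|i]|j] vS vB.
    - exists (Z ord0); split => //. by rewrite !inE. by rewrite !inE.
    - exists (W i); move: vS vB; rewrite !inE ?eqX ?eqU ?eqo /=; split => //; lia.
    - exists (W i); split => //; exact: eqxx.
    - exists (Z j); split => //; exact: eqxx.
  rewrite finset.subUset sub_attr andbT finset.sub1set.
  apply: (@attr_step_forced tower) => [||w wS]; [exact: US1|by rewrite !inE|].
  case: w wS => [[[i|i]|i]|j] //= _ /eqP <-.
  by apply: (fintype.subsetP (sub_attr S1 Odd (stage k (o |: D) :\: E))); rewrite !inE eqxx ?eqxx -ko ltnn.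
have S1max : \max_(v in S1) priority v = k.*2.+2.
  rewrite (bigmax_priority US1) /= ?ko // -ko.
  by move=> -[[[i|i]|i]|j]; rewrite !inE ?eqX /=; lia.
have Smax : \max_(v in S) priority v = k.*2.+3.
  rewrite (bigmax_priority XS) /= ?ko // -ko.
  by move=> -[[[i|i]|i]|j]; rewrite !inE ?eqX /=; lia.
have S1E : zielonka work S1 = ((E, B), work S1 +
    (zielonka work (stage k (o |: D))).2 + (zielonka work E).2).
  rewrite (@zielonka_two_calls _ _ _ Even k.*2.+2 Uk B) //.
  - by rewrite S1U S1B IH2 /= finset.setDv finset.set0U.
  - by apply/set0Pn; exists (U o).
  - by rewrite /parity /= odd_double.
  - rewrite (_ : [set v in _ | _]%SET = Uk) //.
    by apply/setP => -[[[i|i]|i]|j]; rewrite !inE ?eqX ?eqU /=; lia.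
  - rewrite S1U IH1; apply/set0Pn; exists (W o).
    by rewrite !inE ?eqo -ko /=; lia.
  - by rewrite S1U IH1.
(* The top level is attracted in the order [X o], [W o], [U o], starting from a sink; a stray stays
   out because its [X] is absent. *)
have attrE : attr S Even E = stage k.+1 finset.set0.
  apply: (@attr_eq tower).
  - by apply/fintype.subsetP => -[[[i|i]|i]|j]; rewrite !inE ?orbF //; exact: ltnW.
  - apply: attr_closed_Even.
    by move=> -[[[i|i]|i]|j] -[[[i'|i']|i']|j']; rewrite !inE //= => _ _;
      rewrite ?orbF => lt_i' /eqP ->.
  have EA v : v \in E -> v \in attr S Even E.
    exact: (fintype.subsetP (sub_attr S Even E)).
  have US : U o \in S by rewrite inE -ko ltnSn.
  have WS : W o \in S by rewrite inE -ko ltnSn.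
  have step v w : v \in S -> w \in S -> tower_edge v w ->
      w \in attr S Even E -> v \in attr S Even E.
    by move=> vS; apply: (@attr_step tower) => //; rewrite inE.
  have XA : X o \in attr S Even E.
    by apply: (step _ (Z ord0)) => //; [rewrite inE|apply: EA; rewrite inE].
  have WA : W o \in attr S Even E by apply: step XA => //=.
  have UA : U o \in attr S Even E by apply: step WA => //=.
  apply/fintype.subsetP => v vk; case vE: (v \in E); first exact: EA.
  have io (i : 'I_n) : i < k.+1 -> i < k = false -> i = o.
    by move=> ik ki; apply/val_inj; rewrite /= -ko; lia.
  by move: v vk vE => -[[[i|i]|i]|j]; rewrite !inE ?orbF // => ik ki;
    rewrite (io i).
(* The loop on [W o] keeps it from being forced into [X o]. *)
have attrXk : attr S Odd Xk = Xk.
  apply: (@attr_id tower); apply: attr_closed_Odd => v vS vX.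
  case: v vS vX => [[[i|i]|i]|j] vS vX.
  - by exists (Z ord0); split; rewrite // !inE.
  - exists (W i); move: vS; rewrite !inE /=; split => //; lia.
  - exists (W i); split => //; exact: eqxx.
  - exists (Z j); split => //; exact: eqxx.
(* The second call on [S] sees only strays; its time is dropped from the bound. *)
pose C : {set vertex tower} := S :\: stage k.+1 finset.set0.
have C1 : (zielonka work C).1 = (finset.set0, C).
  apply: (@zielonka_const _ _ _ 1) => -[[[i|i]|i]|j]; rewrite !inE /=; lia.
rewrite /spec (@zielonka_two_calls _ _ _ Odd k.*2.+3 Xk (stage k.+1 finset.set0)) //.
- split; first by rewrite /= C1 /= finset.set0U.
  rewrite -/S -/S1 S1E /= expnS.
  by move: (leq_add IHt1 IHt2); rewrite -/E; lia.
- by apply/set0Pn; exists (X o).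
- by rewrite /parity /= odd_double.
- rewrite (_ : [set v in _ | _]%SET = Xk) //.
  by apply/setP => -[[[i|i]|i]|j]; rewrite !inE ?eqX ?eqU /=; lia.
- by rewrite -/S -/S1 S1E /=; apply/set0Pn; exists (Z ord0); rewrite !inE.
- by rewrite -/S -/S1 S1E /=.
Qed.

Lemma zielonka_stage k D : k <= n -> spec k D.
Proof.
elim: k D => [|k IH] D kn; first exact: zielonka_stage0.
by apply: (@zielonka_stage_step k (Ordinal kn)) => // D'; exact/IH/ltnW.
Qed.

Lemma tower_time : 2 ^ n <= (zielonka work [set: vertex tower]%SET).2.
Proof.
have [_] := zielonka_stage finset.set0 (leqnn n).
by congr (_ <= (zielonka work _).2); apply/setP => -[[[i|i]|i]|j]; rewrite !inE ?ltn_ord.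
Qed.

End Tower.

(** * From towers to the asymptotic bound *)

Lemma solitaire_nested (G : parity_game) : solitaire G -> nested_solitaire G.
Proof.
move=> [i Gi] v; exists i => w _ w1; apply: Gi; first by rewrite inE.
apply: leq_trans w1 _; apply: subset_leq_card.
by apply/fintype.subsetP => x; rewrite !inE => /andP[_].
Qed.

(** Any class containing the solitaire games contains the towers, so one argument serves both
    claims. *)
Lemma worst_case_tower (R : realType) (C : parity_game -> Prop)
    (work : forall G : parity_game, {set vertex G} -> nat) :
    (forall G (S : {set vertex G}), 0 < work G S) ->
    (forall G, solitaire G -> C G) ->
  is_Omega (worst_case R C (running_time work))
    (fun n : nat => (2%:R : R) `^ (n%:R / 3%:R))%R.
Proof.
(* With [n] levels and at most 3 sinks, [N <= 3 * n + 3], so rounding costs at most a factor 2. *)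
move=> work0 solC; exists (2%:R^-1)%R; first by rewrite invr_gt0 ltr0n.
near=> N; have N0 : 0 < N by near: N; exact: nbhs_infty_ge.
(* One vertex is set aside for the obligatory sink before dividing. *)
pose n := N.-1 %/ 3; pose G := tower n (N.-1 %% 3).
apply: (@le_trans _ _ ((running_time work G)%:R : R)%:E%E).
  rewrite lee_fin (@le_trans _ _ ((2 ^ n)%:R : R)%R) ?ler_nat ?tower_time //.
  rewrite -[(_^-1)%R]powR_inv1 ?ler0n // -powRD; last by rewrite pnatr_eq0 implybT.
  rewrite natrX -powR_mulrn ?ler0n // ler_powR ?ler1n //.
  rewrite addrC lerBlDr ler_pdivrMr ?ltr0n // natr1 -natrM ler_nat.
  rewrite /n; lia.
apply: ereal_sup_ubound; exists G; split => //; last exact/solC/tower_solitaire.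
by rewrite card_tower /n; lia.
Unshelve. all: by end_near.
Qed.

Theorem theorem3 (R : realType)
    (work : forall G : parity_game, {set vertex G} -> nat)
    (work_gt0 : forall (G : parity_game) (S : {set vertex G}), 0 < work G S) :
  is_Omega (worst_case R solitaire (running_time work))
    (fun n : nat => (2%:R : R) `^ (n%:R / 3%:R))%R /\
  is_Omega (worst_case R nested_solitaire (running_time work))
    (fun n : nat => (2%:R : R) `^ (n%:R / 3%:R))%R.
Proof.
split; apply: worst_case_tower => // G; exact: solitaire_nested.
Qed.
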